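(* Let $Q$ be a precoherent semiprequantale and let $\star$ be any nucleus on $Q$. Then there is a largest finitary nucleus $\star_f$ on $Q$ that is smaller than $\star$, and one has $$x^{\star_f}=\bigvee\{y^\star:\ y\in \mathsf{K}(Q)\text{ and } y\le x\}$$ for all $x\in Q$.
   Context: An ordered magma is a set $M$ with a binary operation (written multiplicatively, not assumed associative, commutative or unital) and a partial order such that $x\le x'$ and $y\le y'$ imply $xy\le x'y'$. A semiprequantale is an ordered magma $Q$ such that for every nonempty subset $X$ of $Q$ that is finite or bounded above, $\bigvee X$ exists and $a(\bigvee X)=\bigvee(aX)$, $(\bigvee X)a=\bigvee(Xa)$ for all $a\in Q$. A directed subset of a poset is a nonempty subset $\Delta$ such that every finite subset of $\Delta$ has an upper bound in $\Delta$. An element $x$ of a poset $S$ is compact if whenever $x\le\bigvee\Delta$ for a directed subset $\Delta$ of $S$ for which $\bigvee\Delta$ exists, one has $x\le y$ for some $y\in\Delta$; $\mathsf{K}(S)$ is the set of compact elements of $S$. An ordered magma $M$ is precoherent if every element of $M$ is the supremum of a set of compact elements and $\mathsf{K}(M)$ is closed under multiplication. For a self-map $\star$ write $x^\star=\star(x)$. A closure operation on a poset is an expansive ($x\le x^\star$), order-preserving, idempotent self-map. A nucleus on an ordered magma $M$ is a closure operation $\star$ with $x^\star y^\star\le (xy)^\star$ for all $x,y\in M$. A closure operation $\star$ on a poset $S$ is finitary if $(\bigvee\Delta)^\star=\bigvee(\Delta^\star)$ for every directed subset $\Delta$ of $S$ for which $\bigvee\Delta$ exists, where $\Delta^\star=\{x^\star:x\in\Delta\}$.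 Self-maps are ordered pointwise: $\star_1$ is smaller than $\star_2$ (written $\star_1\le\star_2$) if $x^{\star_1}\le x^{\star_2}$ for all $x$ (non-strictly). *)

(* Defs.v *)
From HB Require Import structures.
From mathcomp Require Import all_boot all_order.
From mathcomp Require Import boolp classical_sets cardinality.

Set Implicit Arguments.
Unset Strict Implicit.
Unset Printing Implicit Defensive.

Local Open Scope group_scope.
Local Open Scope order_scope.
Local Open Scope classical_set_scope.

(* [x * y] is the bare magma product of [magmaType] (in [group_scope]): it is
   not assumed to be associative, commutative or unital. *)
HB.mixin Record Magma_isOrdered (d : Order.disp_t) M
    of Magma M & Order.POrder d M := {
  le_mulg : forall x x' y y' : M, x <= x' -> y <= y' -> x * y <= x' * y'
}.

#[short(type="orderedMagmaType")]
HB.structure Definition OrderedMagma (d : Order.disp_t) :=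
  { M of Magma M & Order.POrder d M & Magma_isOrdered d M }.

(* Suprema are expressed relationally: [isLub X s] says that the supremum of
   [X] exists and is equal to [s]. *)

Section Poset.
Context {d : Order.disp_t} {S : porderType d}.
Implicit Types (x y s : S) (star : S -> S).

Definition directed (D : set S) : Prop :=
  D !=set0 /\
  forall F : set S, F `<=` D -> finite_set F -> exists2 u, D u & ubound F u.

Definition compact_elt x : Prop :=
  forall (D : set S) s, directed D -> isLub D s -> x <= s ->
    exists2 y, D y & x <= y.

Definition closure_operation star : Prop :=
  [/\ forall x, x <= star x,
      {homo star : x y / x <= y} &
      idempotent_fun star].

Definition finitary star : Prop :=
  forall (D : set S) s, directed D -> isLub D s -> isLub (star @` D) (star s).

Definition le_map (star1 star2 : S -> S) : Prop :=
  forall x, star1 x <= star2 x.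

End Poset.

Section OrderedMagmas.
Context {d : Order.disp_t}.

Definition semiprequantale (Q : orderedMagmaType d) : Prop :=
  forall X : set Q, X !=set0 -> finite_set X \/ has_ubound X ->
    exists s : Q, isLub X s /\
      forall a : Q, isLub [set a * x | x in X] (a * s) /\
                    isLub [set x * a | x in X] (s * a).

Definition precoherent (M : orderedMagmaType d) : Prop :=
  (forall x : M, exists2 A : set M, A `<=` compact_elt & isLub A x) /\
  (forall x y : M, compact_elt x -> compact_elt y -> compact_elt (x * y)).

Definition nucleus (M : orderedMagmaType d) (star : M -> M) : Prop :=
  closure_operation star /\ forall x y : M, star x * star y <= star (x * y).

End OrderedMagmas.

(* Main.v *)
Require Import Defs.
From mathcomp Require Import all_boot all_order.
From mathcomp Require Import boolp classical_sets cardinality.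

Set Implicit Arguments.
Unset Strict Implicit.
Unset Printing Implicit Defensive.

Import Order.TTheory.

(** Write [K(x)] for the set of compact elements below [x]. Finite joins of
    compact elements are compact, so [K(x)] is directed with supremum [x].
    Its image under [star] is directed too; let [starf x] be its supremum. A compact
    element below [starf x] is thus below [star z] for some [z] in [K(x)],
    which gives idempotence; multiplicativity follows from distributivity and
    the closure of compact elements under products. A finitary map is
    determined by its values on compact elements, whence maximality. *)

Local Open Scope group_scope.
Local Open Scope order_scope.
Local Open Scope classical_set_scope.

Definition compacts_below {d : Order.disp_t} {S : porderType d} (x : S) :
  set S := [set y | compact_elt y /\ y <= x].

Section Posets.
Context {d : Order.disp_t} {S : porderType d}.
Implicit Types (x s u : S) (X F D : set S) (f : S -> S).

Lemma isLub_le X s x : isLub X s -> X x -> x <= s.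
Proof. by move=> [sX _]; apply: sX. Qed.

Lemma isLub_least X s u : isLub X s -> ubound X u -> s <= u.
Proof. by move=> [_ leXs]; apply: leXs. Qed.

Lemma isLub_unique X s u : isLub X s -> isLub X u -> s = u.
Proof.
move=> Xs Xu; apply: le_anti; apply/andP; split.
  by apply: (isLub_least Xs) => x; apply: isLub_le Xu.
by apply: (isLub_least Xu) => x; apply: isLub_le Xs.
Qed.

(** A finite part of the image lifts to a finite part of [D], and [f] carries an upper bound of the
    lift to one of the original. *)
Lemma homo_directed f D :
  {homo f : x y / x <= y} -> directed D -> directed (f @` D).
Proof.
move=> fle [[x0 Dx0] Ddir]; split; first by exists (f x0), x0.
move=> F FD finF.
(* [g] selects preimages on [F]; the value [x0] elsewhere only makes it total. *)
have /choice [g gP] y : exists x, F y -> D x /\ f x = y.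
  by have [/FD[x Dx <-]|nFy] := pselect (F y); [exists x | exists x0].
have [||u Du gu] := Ddir (g @` F).
- by move=> _ [y Fy <-]; have [] := gP y Fy.
- exact: finite_image.
exists (f u); first by exists u.
by move=> y Fy; have [_ <-] := gP y Fy; apply/fle/gu; exists y.
Qed.

(** Compactness puts each element of [F] below some member of [D]; directedness bounds these
    finitely many members by a single one. *)
Lemma compact_elt_finite_lub F s :
  F `<=` compact_elt -> finite_set F -> isLub F s -> compact_elt s.
Proof.
move=> cF finF Fs D t Ddir Dt les.
have [[x0 _] Dub] := Ddir.
have /choice [g gP] y : exists x, F y -> D x /\ y <= x.
  have [Fy|nFy] := pselect (F y); last by exists x0.
  have [|x Dx yx] := cF y Fy D t Ddir Dt; last by exists x.
  exact: le_trans (isLub_le Fs Fy) les.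
have [||u Du gu] := Dub (g @` F).
- by move=> _ [y Fy <-]; have [] := gP y Fy.
- exact: finite_image.
exists u => //; apply: (isLub_least Fs) => y Fy.
by have [_ /le_trans] := gP y Fy; apply; apply: gu; exists y.
Qed.

(* If [A] is empty then [x] is the least element of [S], which is compact
   because directed sets are nonempty. *)
Lemma compacts_below_nonempty (A : set S) x :
  A `<=` compact_elt -> isLub A x -> compacts_below x !=set0.
Proof.
move=> cA Ax; have [[a Aa]|/nonemptyPn A0] := pselect (A !=set0).
  by exists a; split; [apply: cA | apply: isLub_le Ax Aa].
exists x; split => // D s [[y Dy] _] _ _; exists y => //.
by apply: (isLub_least Ax) => z; rewrite A0.
Qed.

Lemma isLub_compacts_below (A : set S) x :
  A `<=` compact_elt -> isLub A x -> isLub (compacts_below x) x.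
Proof.
move=> cA Ax; split=> [y [] //|u ux]; apply: (isLub_least Ax) => a Aa.
by apply: ux; split; [apply: cA | apply: isLub_le Ax Aa].
Qed.

End Posets.

Section Semiprequantales.
Context {d : Order.disp_t} {Q : orderedMagmaType d}.
Hypothesis hQ : semiprequantale Q.
Implicit Types (x y s t u : Q) (X Y : set Q).

(** Distributivity is postulated for some supremum of [X]; uniqueness transfers it to the given [s],
    which also bounds [X]. *)
Lemma isLub_mul X s a : X !=set0 -> isLub X s ->
  isLub [set a * x | x in X] (a * s) /\ isLub [set x * a | x in X] (s * a).
Proof.
move=> X0 Xs.
have [||s' [Xs' /(_ a)]] := hQ (X := X) => //.
  by right; exists s; case: Xs.
by rewrite -(isLub_unique Xs Xs').
Qed.

Lemma mul_lub_le X Y s t u :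
    X !=set0 -> Y !=set0 -> isLub X s -> isLub Y t ->
    (forall x y, X x -> Y y -> x * y <= u) ->
  s * t <= u.
Proof.
move=> X0 Y0 Xs Yt leu.
apply: (isLub_least (isLub_mul t X0 Xs).2) => _ [x Xx <-].
apply: (isLub_least (isLub_mul x Y0 Yt).1) => _ [y Yy <-].
exact: leu.
Qed.

Hypothesis cQ : precoherent Q.

Lemma compacts_below_lub x : isLub (compacts_below x) x.
Proof. by have [A cA Ax] := cQ.1 x; apply: isLub_compacts_below cA Ax. Qed.

Lemma compacts_below_directed x : directed (compacts_below x).
Proof.
have [A cA Ax] := cQ.1 x.
have [y0 y0x] := compacts_below_nonempty cA Ax.
split=> [|F Fx finF]; first by exists y0.
(* Only nonempty finite sets are known to have joins, so the empty [F] is bounded by [y0]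
   instead. *)
have [F0|/nonemptyPn F0] := pselect (F !=set0); last first.
  by exists y0 => // z; rewrite F0.
have [s [Fs _]] := hQ F0 (or_introl finF).
exists s; last by case: Fs.
split; first by apply: compact_elt_finite_lub finF Fs => y /Fx[].
by apply: (isLub_least Fs) => y /Fx[].
Qed.

Section FinitaryPart.
Variables star starf : Q -> Q.
Hypothesis hstar : nucleus star.
(** Such a [starf] is produced in [starf_exists]. *)
Hypothesis starfP : forall x, isLub (star @` compacts_below x) (starf x).

Lemma star_le_starf x y : compact_elt y -> y <= x -> star y <= starf x.
Proof. by move=> cy yx; apply: isLub_le (starfP x) _; exists y. Qed.

Lemma starf_least x u :
  (forall y, compact_elt y -> y <= x -> star y <= u) -> starf x <= u.
Proof.
by move=> leu; apply: isLub_least (starfP x) _ => _ [y [cy yx] <-]; apply: leu.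
Qed.

Lemma starf_homo : {homo starf : x y / x <= y}.
Proof.
move=> x y xy; apply: starf_least => z cz zx.
by apply: star_le_starf => //; apply: le_trans zx xy.
Qed.

Lemma starf_expansive x : x <= starf x.
Proof.
have [[star_ge _ _] _] := hstar.
apply: isLub_least (compacts_below_lub x) _ => y [cy yx].
exact: le_trans (star_ge y) (star_le_starf cy yx).
Qed.

Lemma starf_idem : idempotent_fun starf.
Proof.
have [[_ star_homo star_idem] _] := hstar.
move=> x /=; apply: le_anti; rewrite starf_expansive andbT.
apply: starf_least => y cy yx.
have Kdir := homo_directed star_homo (compacts_below_directed x).
(* Compactness of [y] against the directed supremum [starf x] gives [y <= star z], hence
   [star y <= star (star z) = star z]. *)
have [_ [z [cz zx] <-] yz] := cy _ _ Kdir (starfP x) yx.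
apply: le_trans (star_le_starf cz zx).
by rewrite -[leRHS]star_idem /= star_homo.
Qed.

Lemma starf_nucleus : nucleus starf.
Proof.
split; first by split;
  [exact: starf_expansive | exact: starf_homo | exact: starf_idem].
have K0 x : star @` compacts_below x !=set0.
  by have [[y Ky] _] := compacts_below_directed x; exists (star y), y.
(* Distributivity leaves products [star a * star b] with [a], [b] compact; these lie below
   [star (a * b)], where [a * b] is compact and below [x * y]. *)
move=> x y; apply: mul_lub_le (K0 x) (K0 y) (starfP x) (starfP y) _.
move=> _ _ [a [ca ax] <-] [b [cb yb] <-].
apply: le_trans (hstar.2 a b) _.
by apply: star_le_starf; [apply: cQ.2 | apply: le_mulg].
Qed.

(** A compact element below the supremum of [D] is already below a member of [D]. *)
Lemma starf_finitary : finitary starf.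
Proof.
move=> D s Ddir Ds; split=> [_ [x Dx <-]|u uD].
  by apply: starf_homo; apply: isLub_le Ds Dx.
apply: starf_least => y cy ys.
have [x Dx yx] := cy D s Ddir Ds ys.
by apply: le_trans (star_le_starf cy yx) _; apply: uD; exists x.
Qed.

Lemma starf_le_star : le_map starf star.
Proof.
by have [[_ star_homo _] _] := hstar => x; apply: starf_least => y _ /star_homo.
Qed.

Lemma starf_largest (t : Q -> Q) :
  finitary t -> le_map t star -> le_map t starf.
Proof.
move=> tfin tle x.
(* Being finitary, [t] sends the directed supremum [x] of compact elements to the supremum of their
   images. *)
have tx := tfin _ _ (compacts_below_directed x) (compacts_below_lub x).
apply: (isLub_least tx) => _ [y [cy yx] <-].
exact: le_trans (tle y) (star_le_starf cy yx).
Qed.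

End FinitaryPart.

Lemma starf_exists (star : Q -> Q) : {homo star : x y / x <= y} ->
  exists starf : Q -> Q, forall x, isLub (star @` compacts_below x) (starf x).
Proof.
move=> star_homo.
suff /choice[f fP] : forall x, exists s, isLub (star @` compacts_below x) s.
  by exists f.
move=> x.
have [[y Ky] _] := compacts_below_directed x.
have [||s [Ks _]] := hQ (X := star @` compacts_below x); last by exists s.
  by exists (star y), y.
(* The set may be infinite, but monotonicity bounds it by [star x]. *)
by right; exists (star x) => _ [z [_ zx] <-]; apply: star_homo.
Qed.

End Semiprequantales.

Theorem theorem1p6 (d : Order.disp_t) (Q : orderedMagmaType d)
    (hQ : semiprequantale Q) (cQ : precoherent Q)
    (star : Q -> Q) (hstar : nucleus star) :
  exists starf : Q -> Q,
    [/\ nucleus starf /\ finitary starf /\ le_map starf star,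
        forall t : Q -> Q,
          nucleus t -> finitary t -> le_map t star -> le_map t starf &
        forall x : Q,
          isLub [set star y | y in [set y : Q | compact_elt y /\ y <= x]]
                (starf x)].
Proof.
have [[_ star_homo _] _] := hstar.
have [starf starfP] := starf_exists hQ cQ star_homo.
exists starf; split=> [|t _|//]; last exact: (starf_largest hQ cQ starfP).
split; first exact: (starf_nucleus hQ cQ hstar starfP).
split; first exact: (starf_finitary starfP).
exact: (starf_le_star hstar starfP).
Qed.
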